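(* Let ${\bf E}$ be the $n$-dimensional evolution algebra over $\mathbb K$ with natural basis $\{{\bf e}_i\}_{i=1}^n$ and structural matrix $A=(a_{i,j})$ in normal form, and let $\mathcal I_A=\{(i,j): i+1<j<n,\ a_{i,j}\neq 0\}$. Let $R$ be a linear operator on ${\bf E}$. Then $R$ is a Rota-Baxter operator of weight $0$ on ${\bf E}$ if and only if it has one of the following forms. (i) If $\mathcal I_A=\emptyset$: - $(R_1)$ there exist $\alpha\in\mathbb K\setminus\{0\}$, $\beta_1\in\mathbb K$ such that $R({\bf e}_1)=2^{n-1}\alpha{\bf e}_1+\beta_1{\bf e}_n$ and $R({\bf e}_i)=2^{n-i}\alpha{\bf e}_i$ for $i>1$; - $(R_k)$, for some $1<k<n$: there exist $\alpha\in\mathbb K\setminus\{0\}$, $\beta_1,\dots,\beta_k\in\mathbb K$ such that $R({\bf e}_i)=\beta_i{\bf e}_n$ for $i<k$, $R({\bf e}_k)=2^{n-k}\alpha{\bf e}_k+\beta_k{\bf e}_n$, and $R({\bf e}_i)=2^{n-i}\alpha{\bf e}_i$ for $i>k$; - $(R_n)$ there exist $\beta_1,\dots,\beta_n\in\mathbb K$ such that $R({\bf e}_i)=\beta_i{\bf e}_n$ for all $i\le n$. (ii) If $\mathcal I_A\ne\emptyset$, with $i_0=\max\{i:\exists j>i+1 \text{ such that } (i,j)\in\mathcal I_A\}$: - $(R_k)$, for some $i_0<k<n$: there exist $\alpha\in\mathbb K\setminus\{0\}$ and $\beta_1,\dots,\beta_k\in\mathbb K$ such that $R({\bf e}_i)=\beta_i{\bf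 e}_n$ for $i<k$, $R({\bf e}_k)=2^{n-k}\alpha{\bf e}_k+\beta_k{\bf e}_n$, and $R({\bf e}_i)=2^{n-i}\alpha{\bf e}_i$ for $i>k$; - $(R_n)$ there exist $\beta_1,\dots,\beta_n\in\mathbb K$ such that $R({\bf e}_i)=\beta_i{\bf e}_n$ for all $i\le n$.
   Context: $\mathbb K$ is $\mathbb R$ or $\mathbb C$. The evolution algebra with natural basis $\{{\bf e}_i\}_{i=1}^n$ and structural matrix $A=(a_{i,j})$ is the algebra with bilinear multiplication ${\bf e}_i{\bf e}_j={\bf 0}$ for $i\neq j$ and ${\bf e}_i^2=\sum_{j}a_{i,j}{\bf e}_j$. Here ''normal form'' means $A$ is strictly upper triangular ($a_{i,j}=0$ for $j\le i$), $a_{i,i+1}=1$ for all $i<n$, and $a_{i,n}=0$ for all $i\le n-2$; the remaining entries $a_{i,j}\in\mathbb K$ ($i+1<j<n$) are arbitrary. A linear map $R:{\bf E}\to{\bf E}$ is a Rota-Baxter operator of weight $\theta$ if $R({\bf x})R({\bf y})=R(R({\bf x}){\bf y}+{\bf x}R({\bf y})+\theta{\bf x}{\bf y})$ for all ${\bf x},{\bf y}\in{\bf E}$. *)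

(* Defs.v *)
From HB Require Import structures.
From mathcomp Require Import all_boot all_order all_algebra.
From mathcomp Require Import reals complex.

Set Implicit Arguments.
Unset Strict Implicit.
Unset Printing Implicit Defensive.

Import GRing.Theory Num.Theory.
Local Open Scope ring_scope.

Variant scalars := RealScalars | ComplexScalars.

Definition scalar_field (R : realType) (s : scalars) : numFieldType :=
  match s with
  | RealScalars => R
  | ComplexScalars => R[i]
  end.

(* Ordinals count from 0, the mathematical indices from 1: the condition or the
   exponent attached to i : 'I_n is written with [ix i], ranging over 1..n, so
   that the vector of index [ix i] is [e`_i]. *)
Definition ix (n : nat) (i : 'I_n) : nat := i.+1.

Section EvolutionAlgebra.
Variables (K : fieldType) (n : nat) (E : vectType K).
Implicit Types (mul : {bilinear E -> E -> E}) (e : n.-tuple E) (A : 'M[K]_n).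

Definition evolution_algebra mul e A : Prop :=
  [/\ basis_of fullv e,
      forall i j : 'I_n, i != j -> mul e`_i e`_j = 0
    & forall i : 'I_n, mul e`_i e`_i = \sum_(j < n) A i j *: e`_j].

Definition normal_form A : Prop :=
  [/\ forall i j : 'I_n, (ix j <= ix i)%N -> A i j = 0,
      forall i j : 'I_n, ix j = (ix i).+1 -> A i j = 1
    & forall i j : 'I_n, (ix i <= n - 2)%N -> ix j = n -> A i j = 0].

Definition I_set A : {set 'I_n * 'I_n} :=
  [set p | ((ix p.1).+1 < ix p.2 < n)%N && (A p.1 p.2 != 0)].

(* The value is 0 when [I_set A] is empty. *)
Definition i0 A : nat :=
  \max_(i < n | [exists j : 'I_n,
                   ((ix i).+1 < ix j)%N && ((i, j) \in I_set A)]) ix i.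

Definition rota_baxter mul (theta : K) (R : {linear E -> E}) : Prop :=
  forall x y : E,
    mul (R x) (R y) = R (mul (R x) y + mul x (R y) + theta *: mul x y).

Definition e_last e : E := e`_n.-1.

Definition form_R1 e (R : {linear E -> E}) : Prop :=
  exists (alpha beta1 : K), alpha != 0 /\
    forall i : 'I_n,
      (ix i = 1%N ->
         R e`_i = (2 ^+ (n - 1) * alpha) *: e`_i + beta1 *: e_last e) /\
      ((1 < ix i)%N -> R e`_i = (2 ^+ (n - ix i) * alpha) *: e`_i).

(* Only the values of beta at 1..k matter. *)
Definition form_Rk e (k : nat) (R : {linear E -> E}) : Prop :=
  exists (alpha : K) (beta : nat -> K), alpha != 0 /\
    forall i : 'I_n,
      [/\ (ix i < k)%N -> R e`_i = beta (ix i) *: e_last e,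
          ix i = k ->
            R e`_i = (2 ^+ (n - k) * alpha) *: e`_i + beta k *: e_last e
        & (k < ix i)%N -> R e`_i = (2 ^+ (n - ix i) * alpha) *: e`_i].

Definition form_Rn e (R : {linear E -> E}) : Prop :=
  exists beta : nat -> K, forall i : 'I_n, R e`_i = beta (ix i) *: e_last e.

End EvolutionAlgebra.

(* Main.v *)
Require Import Defs.
From HB Require Import structures.
From mathcomp Require Import all_boot all_order all_algebra.
From mathcomp Require Import reals complex ring.

Set Implicit Arguments.
Unset Strict Implicit.
Unset Printing Implicit Defensive.

Import GRing.Theory Num.Theory.
Local Open Scope ring_scope.

(** Write M for the matrix of R in the natural basis (row i holds the
coordinates of R e_i) and lambda_i for its diagonal entries. Testing the
Rota-Baxter identity of weight 0 on e_i and e_j gives the quadratic equations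
[rb_coords],
  sum_k M_ik M_jk e_k^2 = R (M_ij e_j^2 + M_ji e_i^2).
Everything follows from these and from one property of the normal form: the
e_k^2 with k < n are in echelon form, the leading term of e_k^2 being e_(k+1).

With i = j the equation reads sum_k M_ik^2 e_k^2 = 2 lambda_i R(e_i^2). By
descending induction on i the right-hand side lies in the span of the e_l with
l > i, so that comparing leading terms kills M_ik for k < i: the matrix is upper
triangular ([rb_triangular]). The next coefficient gives
lambda_i^2 = 2 lambda_i lambda_(i+1), so the diagonal is 0 before some index and
equal to 2^(n-i) lambda_n from there on ([rb_eigen_step], [rb_eigen_chain]).
If lambda_i = 0 the right-hand side vanishes and R e_i is a multiple of e_n
([rb_eigen0_row]). If lambda_i <> 0, the equation for a pair j < i < n gives lambda_i M_ji = M_ji lambda_(i+1), hence M_ji = 0, since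
lambda_i = 2 lambda_(i+1) ([rb_off_diag]). Thus
R e_i = lambda_i e_i + rho_i e_n for every i < n.

It remains to go back to the case i = j with lambda_i <> 0: now e_i^2 is an
eigenvector of R, of eigenvalue lambda_i / 2 = lambda_(i+1). The nonzero
eigenvalues of R being pairwise distinct, e_i^2 has no component on e_l for
i + 1 < l < n, which is how the index i0 enters ([rb_row_trivial]); so
e_i^2 = e_(i+1), and rho_(i+1) = 0 when i + 1 < n ([rb_last_col]).

Conversely e_n annihilates the algebra, so an operator of the shape
R e_i = lambda_i e_i + rho_i e_n satisfies the identity as soon as
lambda_i^2 e_i^2 = 2 lambda_i R(e_i^2) for all i ([rota_baxter_of_diag]).

In the code indices start at 0 and n = m.+1, so that e_n is the basis vector of
index [ord_max], of value m. *)

(** * The Rota-Baxter equations of a matrix in normal form *)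

(** The coordinates on the basis of the Rota-Baxter identity of weight 0 at a
pair of basis vectors, for the operator whose i-th image has coordinates the
i-th row of M. *)
Definition rb_coords (K : fieldType) (n : nat) (A M : 'M[K]_n) : Prop :=
  forall i j l : 'I_n,
    \sum_k M i k * M j k * A k l =
    \sum_k (M i j * A j k + M j i * A i k) * M k l.

Section NormalForm.
Variables (K : fieldType) (m : nat) (A : 'M[K]_m.+1).
Hypothesis nfA : normal_form A.

Lemma nf_upper (i j : 'I_m.+1) : (j <= i)%N -> A i j = 0.
Proof. by case: nfA => + _ _ => up le_ji; apply: up; rewrite /ix ltnS. Qed.

Lemma nf_last_row (j : 'I_m.+1) : A ord_max j = 0.
Proof. by apply: nf_upper; rewrite -ltnS ltn_ord. Qed.

Lemma nf_super (i j : 'I_m.+1) : j = i.+1 :> nat -> A i j = 1.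
Proof. by case: nfA => _ + _ => sup ji; apply: sup; rewrite /ix ji. Qed.

Lemma nf_last_col (i : 'I_m.+1) : (i.+1 < m)%N -> A i ord_max = 0.
Proof.
case: nfA => _ _ + lt_im => last; apply: last => //.
by rewrite /ix subSS subn1 -ltnS prednK //; apply: leq_ltn_trans lt_im.
Qed.

(** The leading coefficient of a combination of the squares e_k^2: when the
combination starts at k = i, only e_i^2 reaches the index i + 1. *)
Lemma nf_lead (v : 'I_m.+1 -> K) (i l : 'I_m.+1) :
  l = i.+1 :> nat -> (forall k : 'I_m.+1, (k < i)%N -> v k = 0) ->
  \sum_k v k * A k l = v i.
Proof.
move=> li v0; rewrite (bigD1 i) //= nf_super // mulr1 big1 ?addr0 // => k.
rewrite -val_eqE neq_ltn => /orP[lt_ki|lt_ik]; first by rewrite v0 ?mul0r.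
by rewrite nf_upper ?mulr0 // li.
Qed.

(** The squares are in echelon form, so the coefficients of a combination are
read off successively, that of e_k^2 in position k + 1. This is independence of
the squares when s = m; smaller s serve to compare leading terms only. *)
Lemma nf_vanish (v : 'I_m.+1 -> K) (s : nat) :
  (s <= m)%N ->
  (forall l : 'I_m.+1, (l <= s)%N -> \sum_k v k * A k l = 0) ->
  forall k : 'I_m.+1, (k < s)%N -> v k = 0.
Proof.
move=> le_sm sum0 k; have [p] := ubnP (val k).
elim: p k => // p IHp k lt_kp lt_ks.
have lt_k1 : (k.+1 < m.+1)%N by rewrite ltnS (leq_trans lt_ks).
rewrite -(nf_lead (v := v) (i := k) (l := Ordinal lt_k1)) ?sum0 // => j lt_jk.
by apply: IHp; [apply: leq_trans lt_jk _ | apply: ltn_trans lt_ks].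
Qed.

End NormalForm.

(** * Necessity: solving the equations *)

Section RotaBaxterMatrix.
Variables (K : numFieldType) (m : nat) (A M : 'M[K]_m.+1).
Hypothesis nfA : normal_form A.
Hypothesis rbM : rb_coords A M.

Lemma rb_diag (i l : 'I_m.+1) :
  \sum_k M i k ^+ 2 * A k l = 2 * M i i * \sum_k A i k * M k l.
Proof.
have := rbM i i l; under eq_bigr do rewrite -expr2.
move=> ->; rewrite mulr_sumr; apply: eq_bigr => k _.
by rewrite -[RHS]mulrA mulr_natl mulr2n mulrDl mulrA.
Qed.

(** Once the rows after i are known to be triangular, R(e_i^2) has no component
of index at most i, so neither has the sum of the M_ik^2 e_k^2. *)
Lemma rb_triangular (i k : 'I_m.+1) : (k < i)%N -> M i k = 0.
Proof.
have [p] := ubnP (m - i); elim: p i k => // p IHp i k lt_mip lt_ki.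
apply/eqP; rewrite -sqrf_eq0; apply/eqP.
apply: (nf_vanish nfA (v := fun k => M i k ^+ 2) (s := i)) => //; first by rewrite -ltnS.
move=> l le_li; rewrite rb_diag big1 ?mulr0 // => j _.
have [le_ji|lt_ij] := leqP j i; first by rewrite (nf_upper nfA) ?mul0r.
rewrite (IHp j) ?mulr0 ?(leq_ltn_trans le_li) //.
rewrite -ltnS; apply: leq_trans lt_mip; rewrite ltnS ltn_sub2l //.
by rewrite (leq_trans lt_ij) // -ltnS.
Qed.

Lemma rb_square_lead (i l : 'I_m.+1) :
  l = i.+1 :> nat -> \sum_k A i k * M k l = M l l.
Proof.
move=> li; rewrite (bigD1 l) //= (nf_super nfA) // mul1r big1 ?addr0 // => k.
rewrite -val_eqE neq_ltn => /orP[lt_kl|lt_lk]; last by rewrite rb_triangular ?mulr0.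
by rewrite (nf_upper nfA) ?mul0r // -ltnS -li.
Qed.

(** Compare the coefficients of e_(i+1), the lowest term of both sides, in
the equation at the pair (i, i). *)
Lemma rb_eigen_step (i l : 'I_m.+1) :
  l = i.+1 :> nat -> M i i != 0 -> M i i = 2 * M l l.
Proof.
move=> li nz; have := rb_diag i l; rewrite (rb_square_lead li).
rewrite (nf_lead nfA (v := fun k => M i k ^+ 2) li).
  by rewrite expr2 mulrAC; apply: mulIf.
by move=> k lt_ki; rewrite rb_triangular // expr0n.
Qed.

(** The equation at (i, i) becomes a linear relation between the squares with
coefficients M_ik^2. *)
Lemma rb_eigen0_row (i k : 'I_m.+1) :
  M i i = 0 -> (k < m)%N -> M i k = 0.
Proof.
move=> Mi0 lt_km; apply/eqP; rewrite -sqrf_eq0; apply/eqP.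
apply: (nf_vanish nfA (v := fun k => M i k ^+ 2) (s := m)) => // l _.
by rewrite rb_diag Mi0 mulr0 mul0r.
Qed.

Lemma rb_eigen_chain (i : 'I_m.+1) :
  M i i != 0 -> M i i = 2 ^+ (m - i) * M ord_max ord_max.
Proof.
have [p] := ubnP (m - i); elim: p i => // p IHp i lt_mip nz.
have [lt_im|le_mi] := ltnP i m; last first.
  have -> : i = ord_max by apply/val_inj/eqP; rewrite eqn_leq le_mi -ltnS ltn_ord.
  by rewrite subnn mul1r.
have lt_i1 : (i.+1 < m.+1)%N by [].
have step := rb_eigen_step (l := Ordinal lt_i1) erefl nz.
have nz1 : M (Ordinal lt_i1) (Ordinal lt_i1) != 0.
  by apply: contra_neq nz => M0; rewrite step M0 mulr0.
rewrite step IHp //=.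
  by rewrite mulrA -exprS subnSK.
by rewrite -ltnS; apply: leq_trans lt_mip; rewrite ltnS ltn_sub2l.
Qed.

Lemma rb_eigen_up (i j : 'I_m.+1) : (i <= j)%N -> M i i != 0 -> M j j != 0.
Proof.
have [p] := ubnP (j - i); elim: p i => // p IHp i lt_jip le_ij nz.
move: le_ij; rewrite leq_eqVlt => /orP[/eqP/val_inj <- //|lt_ij].
have lt_i1 : (i.+1 < m.+1)%N by apply: leq_ltn_trans lt_ij _.
apply: (IHp (Ordinal lt_i1)) => //=.
  by rewrite -ltnS; apply: leq_trans lt_jip; rewrite ltnS ltn_sub2l.
have step := rb_eigen_step (l := Ordinal lt_i1) erefl nz.
by apply: contra_neq nz => M0; rewrite step M0 mulr0.
Qed.

(** For j < i with both eigenvalues nonzero, the coefficient of e_(i+1) in the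
equation at (i, j) is lambda_i M_ji = M_ji lambda_(i+1), whereas
lambda_i = 2 lambda_(i+1). *)
Lemma rb_off_diag (j i : 'I_m.+1) : (i < m)%N -> i != j -> M j i = 0.
Proof.
move=> lt_im; rewrite -val_eqE neq_ltn => /orP[|lt_ji].
  exact: rb_triangular.
have [Mj0|nzj] := eqVneq (M j j) 0; first exact: rb_eigen0_row.
have nzi : M i i != 0 by apply: rb_eigen_up nzj; apply: ltnW.
have lt_i1 : (i.+1 < m.+1)%N by [].
pose l := Ordinal lt_i1.
have step : M i i = 2 * M l l by apply: rb_eigen_step.
have : \sum_k M i k * M j k * A k l = M j i * \sum_k A i k * M k l.
  rewrite rbM (rb_triangular lt_ji) mulr_sumr; apply: eq_bigr => k _.
  by rewrite mul0r add0r mulrA.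
rewrite (@rb_square_lead i l erefl).
rewrite (nf_lead nfA (v := fun k => M i k * M j k) (i := i)) //; last first.
  by move=> k lt_ki; rewrite (rb_triangular lt_ki) mul0r.
rewrite mulrC => /eqP; rewrite -subr_eq0 -mulrBr mulf_eq0 => /orP[/eqP //|].
rewrite step mulr_natl mulr2n addrK => /eqP Ml0.
by move: nzi; rewrite step Ml0 mulr0 eqxx.
Qed.

(** Since R e_j is a combination of e_j and of e_n, whose square is 0, the
equation at (j, j) says that e_j^2 is an eigenvector of R. *)
Lemma rb_diag_nz (j l : 'I_m.+1) :
  (j < m)%N -> M j j != 0 -> M j j * A j l = 2 * \sum_k A j k * M k l.
Proof.
move=> lt_jm nz; apply: (mulfI nz).
rewrite /= [RHS]mulrCA [LHS]mulrA -expr2 [RHS]mulrA -rb_diag (bigD1 j) //=.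
rewrite big1 ?addr0 // => k ne_kj.
have [lt_km|le_mk] := ltnP k m; first by rewrite rb_off_diag ?expr0n ?mul0r.
by rewrite (nf_upper nfA) ?mulr0 // (leq_trans _ le_mk) // -ltnS.
Qed.

(** Comparing the coefficients of e_l in R(e_j^2) = lambda_(j+1) e_j^2, a nonzero
one forces lambda_l = lambda_(j+1); but these are multiples of lambda_n <> 0 by
distinct powers of 2. *)
Lemma rb_row_trivial (j l : 'I_m.+1) :
  M j j != 0 -> (j.+1 < l)%N -> (l < m)%N -> A j l = 0.
Proof.
move=> nz lt_jl lt_lm.
have lt_jm : (j < m)%N by apply: ltn_trans lt_lm; apply: ltn_trans lt_jl.
have nzl : M l l != 0 by apply: rb_eigen_up nz; rewrite ltnW // ltnW.
have := rb_diag_nz l lt_jm nz.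
rewrite (bigD1 l) //= big1 ?addr0; last first.
  by move=> k ne_kl; rewrite rb_off_diag ?mulr0 // eq_sym.
rewrite mulrCA mulrC => /eqP; rewrite -subr_eq0 -mulrBr mulf_eq0.
case/orP=> [/eqP //|]; rewrite subr_eq0 rb_eigen_chain // (rb_eigen_chain nzl).
have nzm : M ord_max ord_max != 0 by apply: rb_eigen_up nz; rewrite -ltnS.
rewrite mulrA -exprS (inj_eq (mulIf nzm)) -!natrX eqr_nat eqn_exp2l // => /eqP E.
have : (m - j <= m - j.+1)%N by rewrite E ltn_sub2l // (ltn_trans lt_jl).
by rewrite leqNgt ltn_sub2l.
Qed.

(** By the preceding lemma e_j^2 = e_l, so that e_l is itself an
eigenvector of R. *)
Lemma rb_last_col (j l : 'I_m.+1) :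
  M j j != 0 -> l = j.+1 :> nat -> (l < m)%N -> M l ord_max = 0.
Proof.
move=> nz lj lt_lm.
have lt_jm : (j < m)%N by apply: ltn_trans lt_lm; rewrite lj.
have := rb_diag_nz ord_max lt_jm nz.
rewrite (nf_last_col nfA) -?lj // mulr0 (bigD1 l) //= (nf_super nfA) // mul1r big1 ?addr0.
  by move/esym/eqP; rewrite mulf_eq0 pnatr_eq0 => /eqP.
move=> k ne_kl; have [le_kj|lt_jk] := leqP k j; first by rewrite (nf_upper nfA) ?mul0r.
have [lt_km|le_mk] := ltnP k m.
  rewrite rb_row_trivial ?mul0r // -lj ltn_neqAle lj lt_jk -lj andbT.
  by rewrite eq_sym val_eqE.
have -> : k = ord_max by apply/val_inj/eqP; rewrite eqn_leq le_mk -ltnS ltn_ord.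
by rewrite (nf_last_col nfA) ?mul0r // -lj.
Qed.

(** The index k is the first one below m with a nonzero eigenvalue; the first
alternative is the absence of such an index. *)
Lemma rb_classification :
  (forall i l : 'I_m.+1, (l < m)%N -> M i l = 0) \/
  exists k : 'I_m.+1,
    [/\ (k < m)%N, M ord_max ord_max != 0,
        forall i l : 'I_m.+1, (i < k)%N -> (l < m)%N -> M i l = 0,
        forall i l : 'I_m.+1, (k <= i)%N -> (l < m)%N ->
          M i l = (2 ^+ (m - i) * M ord_max ord_max) *+ (i == l)
      & (forall i : 'I_m.+1, (k < i < m)%N -> M i ord_max = 0) /\
        (forall i j : 'I_m.+1,
          (k <= i)%N -> (i.+1 < j)%N -> (j < m)%N -> A i j = 0)].
Proof.
case: (pickP (fun i : 'I_m.+1 => (i < m)%N && (M i i != 0))) => [k0 Pk0|none].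
  case: (@arg_minnP _ _ (fun i : 'I_m.+1 => (i < m)%N && (M i i != 0)) val Pk0)
    => k /andP[lt_km nzk] min_k.
  right; exists k; split=> //.
  - by apply: rb_eigen_up nzk; apply: ltnW.
  - move=> i l lt_ik lt_lm; apply: rb_eigen0_row lt_lm.
    have [//|nzi] := eqVneq (M i i) 0; have := min_k i.
    by rewrite nzi (ltn_trans lt_ik) // => /(_ isT); rewrite leqNgt lt_ik.
  - move=> i l le_ki lt_lm; have [<-|ne_il] := eqVneq i l.
      by rewrite rb_eigen_chain // (rb_eigen_up le_ki).
    by rewrite rb_off_diag // eq_sym.
  split=> [i /andP[lt_ki lt_im]|i j le_ki]; last first.
    by apply: rb_row_trivial; apply: rb_eigen_up nzk.
  case: i lt_ki lt_im => [[//|i] lt_i] lt_ki lt_im.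
  by apply: (rb_last_col (j := Ordinal (ltnW lt_i))) => //; apply: rb_eigen_up nzk.
left=> i l lt_lm; have [lt_im|le_mi] := ltnP i m.
  by apply: rb_eigen0_row => //; apply/eqP; have := none i; rewrite lt_im => /negbFE.
by apply: rb_triangular; apply: leq_trans le_mi.
Qed.

End RotaBaxterMatrix.

(** * Evolution algebras in coordinates *)

Section Algebra.
Variables (K : fieldType) (m : nat) (E : vectType K).
Variables (mul : {bilinear E -> E -> E}) (e : m.+1.-tuple E) (A : 'M[K]_m.+1).
Hypothesis evoE : evolution_algebra mul e A.

Lemma evo_expand (x : E) : x = \sum_i coord e i x *: e`_i.
Proof. by case: evoE => be _ _; apply: coord_basis be (memvf x). Qed.

Lemma evo_mul_basis (x : E) (j : 'I_m.+1) :
  mul x e`_j = coord e j x *: mul e`_j e`_j.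
Proof.
case: evoE => _ orth _; rewrite {1}(evo_expand x) linear_sumlz (bigD1 j) //=.
rewrite linearZl_LR big1 ?addr0 // => i ne_ij.
by rewrite linearZl_LR orth // scaler0.
Qed.

Lemma evo_mul (x y : E) :
  mul x y = \sum_k (coord e k x * coord e k y) *: mul e`_k e`_k.
Proof.
rewrite {1}(evo_expand y) linear_sumr; apply: eq_bigr => k _.
by rewrite linearZr_LR evo_mul_basis scalerA mulrC.
Qed.

Lemma evo_mulC (x y : E) : mul x y = mul y x.
Proof. by rewrite !evo_mul; apply: eq_bigr => k _; rewrite mulrC. Qed.

Lemma coord_evo_mul (x y : E) (l : 'I_m.+1) :
  coord e l (mul x y) = \sum_k coord e k x * coord e k y * A k l.
Proof.
case: evoE => be _ sq; rewrite evo_mul linear_sum; apply: eq_bigr => k _.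
by rewrite linearZ /= sq coord_sum_free ?(basis_free be).
Qed.

Variable R : {linear E -> E}.

Lemma rb_coords_of_rota_baxter :
  rota_baxter mul 0 R -> rb_coords A (\matrix_(i, j) coord e j (R e`_i)).
Proof.
case: evoE => be _ sq rb i j l; have := congr1 (coord e l) (rb e`_i e`_j).
rewrite coord_evo_mul scale0r addr0 (evo_mul_basis (R e`_i)).
rewrite (evo_mulC e`_i) (evo_mul_basis (R e`_j)).
move=> rb_l; under eq_bigr do rewrite !mxE.
under [RHS]eq_bigr do rewrite !mxE.
rewrite rb_l !sq !scaler_sumr -big_split /= !linear_sum.
apply: eq_bigr => k _.
by rewrite !scalerA -scalerDl !linearZ.
Qed.

Lemma rota_baxter_of_basis :
  (forall i j : 'I_m.+1,
     mul (R e`_i) (R e`_j) = R (mul (R e`_i) e`_j + mul e`_i (R e`_j))) ->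
  rota_baxter mul 0 R.
Proof.
move=> rb; have rb_r (i : 'I_m.+1) y :
     mul (R e`_i) (R y) = R (mul (R e`_i) y + mul e`_i (R y)).
  rewrite (evo_expand y) !linear_sum -big_split linear_sum /=.
  apply: eq_bigr => j _.
  by rewrite !linearZ -scalerDr linearZ /= rb.
move=> x y; rewrite scale0r addr0 (evo_expand x).
rewrite (linear_sum R) !linear_sumlz -big_split linear_sum /=.
apply: eq_bigr => i _.
by rewrite !linearZ !linearZl_LR -scalerDr linearZ /= rb_r.
Qed.

Hypothesis nfA : normal_form A.

Lemma mul_lastl (y : E) : mul (e_last e) y = 0.
Proof.
case: evoE => _ _ sq; rewrite evo_mulC -[e_last e]/(e`_(@ord_max m)).
rewrite (evo_mul_basis y ord_max) (sq ord_max).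
by rewrite big1 ?scaler0 // => j _; rewrite (nf_last_row nfA) ?scale0r.
Qed.

(** Multiplication by R e_i is lambda_i times multiplication by e_i, because e_n
annihilates the algebra; orthogonality of the basis then
leaves only the identities at the pairs (i, i). *)
Lemma rota_baxter_of_diag (lam rho : 'I_m.+1 -> K) :
  (forall i : 'I_m.+1, R e`_i = lam i *: e`_i + rho i *: e_last e) ->
  (forall i : 'I_m.+1,
     lam i ^+ 2 *: mul e`_i e`_i = (lam i *+ 2) *: R (mul e`_i e`_i)) ->
  rota_baxter mul 0 R.
Proof.
move=> Re eig; have mulR (i : 'I_m.+1) y : mul (R e`_i) y = lam i *: mul e`_i y.
  by rewrite Re linearDl !linearZl_LR mul_lastl scaler0 addr0.
apply: rota_baxter_of_basis => i j.
rewrite !mulR (evo_mulC e`_i (R _)) mulR (evo_mulC e`_j).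
have [<-|ne_ij] := eqVneq i j.
  by rewrite scalerA -expr2 eig -scalerDl -mulr2n linearZ.
by case: evoE => _ -> // _; rewrite !scaler0 addr0 linear0.
Qed.

End Algebra.

(** * The index i0 and the forms of the operator *)

Section IZero.
Variables (K : fieldType) (m : nat) (A : 'M[K]_m.+1).

(** The normal form settles all the other entries of these rows, so the bound on
i0 means that e_i^2 = e_(i+1) for k <= i < m. *)
Lemma i0_leP (k : nat) :
  reflect (forall i j : 'I_m.+1, (k <= i)%N -> (i.+1 < j)%N -> (j < m)%N -> A i j = 0)
          (i0 A <= k)%N.
Proof.
rewrite /i0; apply: (iffP (bigmax_leqP _ _ _)) => [le_k i j le_ki lt_ij lt_jm | A0 i].
  apply/eqP; apply: contraLR le_ki => nzA; rewrite -ltnNge; apply: le_k.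
  by apply/existsP; exists j; rewrite inE /ix /= !ltnS lt_ij lt_jm nzA.
case/existsP=> j; rewrite inE /ix /= !ltnS => /andP[_ /andP[/andP[lt_ij lt_jm] nzA]].
by rewrite ltnNge; apply: contraNN nzA => le_ki; rewrite A0.
Qed.

Lemma i0_eq0 : I_set A = set0 -> i0 A = 0%N.
Proof.
move=> I0; apply/eqP; rewrite -leqn0; apply/bigmax_leqP=> i /existsP[j].
by rewrite I0 inE andbF.
Qed.

End IZero.

Section FormR1.
Variables (K : fieldType) (E : vectType K).

Lemma form_R1_Rk (n : nat) (e : n.-tuple E) (R : {linear E -> E}) :
  form_R1 e R <-> form_Rk e 1 R.
Proof.
split=> [[alpha [beta1 [nz Re]]]|[alpha [beta [nz Re]]]].
  exists alpha, (fun=> beta1); split=> // i; have [R1 Rgt] := Re i.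
  by split.
exists alpha, (beta 1%N); split=> // i; have [_ R1 Rgt] := Re i.
by split.
Qed.

(** In dimension 1 the first and last basis vectors coincide and no index k
satisfies 0 < k < n, so that the form R1 falls under Rn. *)
Lemma form_R1_Rn (e : 1.-tuple E) (R : {linear E -> E}) :
  form_R1 e R -> form_Rn e R.
Proof.
case=> alpha [beta1 [_ Re]]; exists (fun=> alpha + beta1) => i.
have [R1 _] := Re i; rewrite R1 /ix; last by rewrite ord1.
by rewrite subnn mul1r ord1 -scalerDl.
Qed.

End FormR1.

Section Forms.
Variables (K : numFieldType) (m : nat) (E : vectType K).
Variables (mul : {bilinear E -> E -> E}) (e : m.+1.-tuple E) (A : 'M[K]_m.+1).
Hypothesis evoE : evolution_algebra mul e A.
Hypothesis nfA : normal_form A.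
Variable R : {linear E -> E}.

Lemma rota_baxter_of_Rn : form_Rn e R -> rota_baxter mul 0 R.
Proof.
case=> beta Re; apply: (rota_baxter_of_diag evoE nfA (lam := fun=> 0)) => i.
  by rewrite scale0r add0r; apply: Re.
by rewrite expr0n mul0rn !scale0r.
Qed.

Lemma rota_baxter_of_Rk (k : nat) :
  (i0 A < k < m.+1)%N -> form_Rk e k R -> rota_baxter mul 0 R.
Proof.
case: k => // k /andP[/i0_leP row0 lt_km] [alpha [beta [nz Re]]].
pose lam (i : 'I_m.+1) := if (k <= i)%N then 2 ^+ (m - i) * alpha else 0.
pose rho (i : 'I_m.+1) := if (i <= k)%N then beta (ix i) else 0.
apply: (rota_baxter_of_diag evoE nfA (lam := lam) (rho := rho)) => i.
  rewrite /lam /rho; have [Rlt Req Rgt] := Re i; rewrite /ix !ltnS in Rlt Req Rgt.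
  case: (ltngtP i k) => ik.
  - by rewrite Rlt // scale0r add0r.
  - by rewrite Rgt // scale0r addr0.
  - by rewrite Req /ix ik ?subSS.
rewrite /lam; case: leqP => le_ki; last by rewrite expr0n mul0rn !scale0r.
have [le_mi|lt_im] := leqP m i.
  have -> : i = ord_max by apply/val_inj/eqP; rewrite eqn_leq le_mi -ltnS ltn_ord.
  by rewrite (mul_lastl evoE nfA) !linear0.
have lt_i1 : (i.+1 < m.+1)%N by [].
have -> : mul e`_i e`_i = e`_(Ordinal lt_i1).
  case: evoE => _ _ ->; rewrite (bigD1 (Ordinal lt_i1)) //= (nf_super nfA) // scale1r.
  rewrite big1 ?addr0 // => j; rewrite -val_eqE neq_ltn /= ltnS.
  case/orP=> [le_ji|lt_ij]; first by rewrite (nf_upper nfA) ?scale0r.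
  have [lt_jm|le_mj] := ltnP j m; first by rewrite row0 ?scale0r.
  have j_max : j = ord_max by apply/val_inj/eqP; rewrite eqn_leq le_mj -ltnS ltn_ord.
  by rewrite j_max (nf_last_col nfA) ?scale0r // (leq_trans lt_ij) // -ltnS.
have [_ _ -> //] := Re (Ordinal lt_i1).
have -> : 2 ^+ (m - i) = 2 * 2 ^+ (m - i.+1) :> K by rewrite -exprS subnSK.
rewrite scalerA /ix /= subSS; congr (_ *: _); ring.
Qed.

(** The matrix classification has a 0-based index k, hence the form of
1-based index k.+1. *)
Lemma forms_of_rota_baxter :
  rota_baxter mul 0 R ->
  (exists k : nat, (i0 A < k < m.+1)%N /\ form_Rk e k R) \/ form_Rn e R.
Proof.
move=> /(rb_coords_of_rota_baxter evoE); set M := (\matrix_(i, j) _) => rbM.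
pose beta (p : nat) : K := M (inord p.-1) ord_max.
have Re (i : 'I_m.+1) (c : K) :
    (forall l : 'I_m.+1, (l < m)%N -> M i l = c *+ (i == l)) ->
    R e`_i = (if (i < m)%N then c else 0) *: e`_i + beta (ix i) *: e_last e.
  move=> Mi; rewrite {1}(evo_expand evoE (R e`_i)) (bigD1 ord_max) //= addrC.
  rewrite /beta /ix /= inord_val mxE; congr (_ + _).
  (* Away from e_n the row is diagonal; for i = m the only diagonal entry is the
     one that has been split off, hence the coefficient 0. *)
  transitivity (\sum_(l < m.+1 | l != ord_max) (c *+ (i == l)) *: e`_l).
    apply: eq_bigr => l; rewrite -val_eqE /= => ne_lm.
    by rewrite -Mi ?mxE // ltn_neqAle ne_lm -ltnS /=.
  have [lt_im|le_mi] := ltnP i m.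
    rewrite (bigD1 i) /=; last by rewrite -val_eqE neq_ltn lt_im.
    rewrite eqxx big1 ?addr0 // => l /andP[_ ne_li].
    by rewrite eq_sym (negbTE ne_li) scale0r.
  rewrite big1 ?scale0r // => l; rewrite -val_eqE => ne_lm.
  have [il|_] := eqVneq i l; last by rewrite scale0r.
  by case/negP: ne_lm; rewrite -il eqn_leq le_mi -ltnS ltn_ord.
case: (rb_classification nfA rbM) => [M0|[k [lt_km nz M0 Mdiag [Mlast row0]]]].
  right; exists beta => i; rewrite (Re i 0) => [|l lt_lm].
    by rewrite if_same scale0r add0r.
  by rewrite mul0rn M0.
left; exists k.+1; split; first by rewrite !ltnS lt_km andbT; apply/i0_leP.
exists (M ord_max ord_max), beta; split=> // i; rewrite /ix subSS !ltnS.
split=> [lt_ik|[ik]|lt_ki].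
- rewrite (Re i 0) => [|l lt_lm]; first by rewrite if_same scale0r add0r.
  by rewrite mul0rn M0.
- rewrite (Re i _ (fun l => Mdiag i l _)) ?ik // lt_km /ix ik //.
- have [lt_im|le_mi] := ltnP i m.
    rewrite (Re i _ (fun l => Mdiag i l (ltnW lt_ki))) lt_im /beta /= inord_val.
    by rewrite (Mlast i) ?lt_ki // scale0r addr0 subSS.
  have i_max : i = ord_max by apply/val_inj/eqP; rewrite eqn_leq le_mi -ltnS ltn_ord.
  rewrite (Re i _ (fun l => Mdiag i l (ltnW lt_ki))) ltnNge le_mi scale0r add0r.
  by rewrite /beta /= inord_val i_max subnn mul1r.
Qed.

(** Allowing k = 1 when i0 = 0 merges R1 into the family R_k and makes a single
statement of the two cases. *)
Theorem rota_baxter_formP :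
  rota_baxter mul 0 R <->
  (exists k : nat, (i0 A < k < m.+1)%N /\ form_Rk e k R) \/ form_Rn e R.
Proof.
split; first exact: forms_of_rota_baxter.
by case=> [[k [lt_k /(rota_baxter_of_Rk lt_k)]]|/rota_baxter_of_Rn].
Qed.

End Forms.

Theorem theorem4p5 (RR : realType) (s : scalars) (n : nat) (hn : (0 < n)%N)
    (E : vectType (scalar_field RR s)) (mul : {bilinear E -> E -> E})
    (e : n.-tuple E) (A : 'M[scalar_field RR s]_n)
    (hE : evolution_algebra mul e A) (hA : normal_form A)
    (R : {linear E -> E}) :
  (I_set A = set0 ->
     (rota_baxter mul 0 R <->
        [\/ form_R1 e R,
            exists k : nat, (1 < k < n)%N /\ form_Rk e k R
          | form_Rn e R])) /\
  (I_set A <> set0 ->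
     (rota_baxter mul 0 R <->
        (exists k : nat, (i0 A < k < n)%N /\ form_Rk e k R) \/ form_Rn e R)).
Proof.
case: n hn e A hE hA => // m _ e A hE hA.
split=> [I0|_]; last exact: rota_baxter_formP.
rewrite (rota_baxter_formP hE hA) i0_eq0 //; split.
  case=> [[k [lt_k Rk]]|]; last by constructor 3.
  case: k lt_k Rk => [//|[|k]] lt_k Rk.
    by constructor 1; apply/form_R1_Rk.
  by constructor 2; exists k.+2.
case=> [R1|[k [/andP[lt_1k lt_kn] Rk]]|]; last by right.
  have [m0|m_gt0] := posnP m; last by left; exists 1%N; split=> //; apply/form_R1_Rk.
  right; move: e R1 {A hE hA I0}; rewrite m0 => e R1. exact: form_R1_Rn R1.
by left; exists k; rewrite lt_kn (ltnW lt_1k).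
Qed.
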